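(* Let $K$ be a metric space and let $f\in SD(K)$ be real-valued. Then $\|f\|_{B_{1/4}}=\|f\|_D$.
   Context: $D(K)$ is the set of all $f:K\to\mathbb{C}$ of the form $f=(\varphi_1-\varphi_2)+i(\varphi_3-\varphi_4)$ with $\varphi_1,\dots,\varphi_4$ bounded real-valued lower semi-continuous functions on $K$. Equivalently, $f\in D(K)$ iff there is a sequence $(\varphi_j)$ of continuous complex-valued functions on $K$ with $\sup_{k\in K}\sum_j|\varphi_j(k)|<\infty$ and $f=\sum_j\varphi_j$ pointwise; $\|f\|_D$ is the infimum of $\sup_{k\in K}\sum_j|\varphi_j(k)|$ over all such sequences. A function is simple if its range is finite. $SD(K)$ is the closure, in $(D(K),\|\cdot\|_D)$, of the set of simple functions belonging to $D(K)$. $B_{1/4}(K)$ is the set of all $f:K\to\mathbb{C}$ for which there exist $(f_n)$ in $D(K)$ and $\lambda<\infty$ with $f_n\to f$ uniformly and $\|f_n\|_D\le\lambda$ for all $n$; $\|f\|_{B_{1/4}}$ is the infimum of such $\lambda$ (over all such sequences). *)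

(* Defs.v *)
From HB Require Import structures.
From mathcomp Require Import all_boot all_order all_algebra.
From mathcomp Require Export complex.
From mathcomp Require Import all_classical all_reals all_analysis.

Set Implicit Arguments.
Unset Strict Implicit.
Unset Printing Implicit Defensive.

Import Order.TTheory GRing.Theory Num.Theory.
Import numFieldNormedType.Exports.

Local Open Scope classical_set_scope.
Local Open Scope ring_scope.
Local Open Scope complex_scope.

(* The regular algebra R[i]^o is R[i] itself; it is the form under which the
   library infers the norm topology and uniformity of the complex numbers. *)
Notation Cplx R := (R[i]^o) (only parsing).

Section Definitions.
Context {R : realType} {K : metricType R}.
Implicit Types (f g : K -> Cplx R) (phi : nat -> K -> Cplx R) (p : K -> R).

Definition bounded_lsc p : Prop :=
  bounded_fun p /\ lower_semicontinuous (EFin \o p).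

Definition classD : set (K -> Cplx R) :=
  [set f | exists p1 p2 p3 p4 : K -> R,
    [/\ bounded_lsc p1, bounded_lsc p2, bounded_lsc p3, bounded_lsc p4 &
        f = fun k => (p1 k - p2 k) +i* (p3 k - p4 k)]].

(* normc is the R-valued modulus, whereas `|z| is R[i]-valued. *)
Definition sup_abs_sum phi : \bar R :=
  ereal_sup [set (\sum_(0 <= j <oo) (ComplexField.Normc.normc (phi j k))%:E)%E
            | k in [set: K]].

Definition D_series f : set (nat -> K -> Cplx R) :=
  [set phi | [/\ forall j, continuous (phi j),
                 (sup_abs_sum phi < +oo)%E &
                 forall k, series (fun j => phi j k) @ \oo --> f k]].

(* Only meaningful for f in classD, where D_series f is nonempty (the real inf
   of the empty set is 0). On an empty K, fine sends the supremum -oo to 0. *)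
Definition normD f : R := inf [set fine (sup_abs_sum phi) | phi in D_series f].

Definition simple f : Prop := finite_set (range f).

Definition classSD : set (K -> Cplx R) :=
  [set f | classD f /\
     forall e : R, 0 < e ->
       exists2 g, classD g /\ simple g & normD (f \- g) < e].

Definition B14_bounds f : set R :=
  [set lambda | exists f_ : nat -> K -> Cplx R,
     [/\ forall n, classD (f_ n),
         {uniform, f_ @ \oo --> f} &
         forall n, normD (f_ n) <= lambda]].

Definition classB14 : set (K -> Cplx R) := [set f | B14_bounds f !=set0].

(* Only meaningful for f in classB14, which contains classD. *)
Definition normB14 f : R := inf (B14_bounds f).

End Definitions.

(* Main.v *)
(** Let [f_ n] tend to [f] uniformly with [normD (f_ n) <= M], and let [g] be
    simple with [normD (f \- g) < e]. Then [h := f_ n \- (f \- g)] is uniformly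
    close to [g], and [normD h <= M + e]. Since [g] has finitely many values,
    there is a [(1 + e)]-Lipschitz function [theta] with [theta 0 = 0] which
    sends everything close to a value of [Re g] to that value, so that
    [theta \o Re h = Re g]. Applying [theta] to the partial sums of a series for
    [h] gives [normD (Re g) <= (1 + e) * normD h], because the increments of the
    partial sums grow by a factor of at most [1 + e]; now add [Re (f \- g)]. *)
Require Import Defs.
From mathcomp Require Import all_boot all_order all_algebra.
From mathcomp Require Import all_classical all_reals all_analysis.
From mathcomp Require Import ring lra.

Set Implicit Arguments.
Unset Strict Implicit.
Unset Printing Implicit Defensive.

Import Order.TTheory GRing.Theory Num.Theory.
Import numFieldNormedType.Exports.

Local Open Scope classical_set_scope.
Local Open Scope ring_scope.
Local Open Scope complex_scope.

Local Notation normc := ComplexField.Normc.normc.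

(** * Lipschitz maps flattening neighbourhoods of finitely many values *)

(* With [gap] the least distance between points of [0 :: s] (at most 1), [theta]
   is the McShane extension of the function equal to [a] within distance [delta]
   of each [a] in [0 :: s], which is [L]-Lipschitz because
   [gap = L * (gap - 2 * delta)]. *)
Lemma flat_lipschitz (R : realType) (s : seq R) (L : R) : 1 < L ->
  exists (theta : R -> R) (delta : R),
    [/\ 0 < delta, theta 0 = 0,
        forall x y, `|theta x - theta y| <= L * `|x - y| &
        forall a x, a \in s -> `|x - a| <= delta -> theta x = a].
Proof.
move=> L1; have L0 : 0 < L by lra.
pose t := 0 :: s.
pose gap := \big[Num.min/(1:R)]_(p <- [seq (a, b) | a <- t, b <- t] | p.1 < p.2)
  (p.2 - p.1).
have gap0 : 0 < gap by apply: lt_bigmin => // -[a b] /=; rewrite subr_gt0.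
have gapP a b : a \in t -> b \in t -> a < b -> gap <= b - a.
  move=> ta tb ab.
  by apply: (@bigmin_inf_seq _ _ _ _ _ (a, b)) => //; exact: allpairs_f.
pose delta := (L - 1) / (2 * L) * gap.
have delta0 : 0 < delta by rewrite mulr_gt0 ?divr_gt0//; lra.
have deltaE : L * (2 * delta) = (L - 1) * gap.
  by rewrite /delta !mulrA; congr (_ * _); field; lra.
pose F a x := a + L * Num.max 0 (`|x - a| - delta).
have F_lip a x y : F a x <= F a y + L * `|x - y|.
  rewrite /F -addrA lerD2l -mulrDr ler_pM2l// ge_max.
  have xya := ler_distD y x a; have xy0 := normr_ge0 (x - y).
  by rewrite addr_maxl; apply/andP; split; rewrite le_max; apply/orP;
    [left|right]; lra.
(* The default [F 0 x] does not affect the minimum, since [0] heads [t]. *)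
pose theta x := \big[Num.min/F 0 x]_(a <- t) F a x.
have theta_lip x y : theta x <= theta y + L * `|x - y|.
  rewrite -lerBlDr [leRHS]big_seq; apply: le_bigmin => [|a ta].
    by rewrite lerBlDr (le_trans (bigmin_le_id _ _ _ _)).
  by rewrite lerBlDr; apply: bigmin_inf_seq ta _ _.
have thetaE a x : a \in t -> `|x - a| <= delta -> theta x = a.
  move=> ta xa.
  have Fax : F a x = a by rewrite /F max_l ?mulr0 ?addr0// subr_le0.
  (* For [b < a], [F b x >= b + L * (a - b - 2 * delta)], which is at least [a] by [deltaE] and
     [gap <= a - b]. *)
  have FF b : b \in t -> a <= F b x.
    move=> tb.
    have [ab|ba] := leP a b.
      by rewrite (le_trans ab)// lerDl mulr_ge0// ?le_max ?lexx// ltW.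
    have gap_le := gapP _ _ tb ta ba.
    have abx : a - b - 2 * delta <= Num.max 0 (`|x - b| - delta).
      have := ler_distD x a b; rewrite (distrC a x) => tri.
      by rewrite le_max; apply/orP; right; have := ler_norm (a - b); lra.
    rewrite -lerBlDl (le_trans _ (ler_wpM2l (ltW L0) abx))// mulrBr deltaE.
    have : (L - 1) * gap <= (L - 1) * (a - b) by rewrite ler_wpM2l//; lra.
    lra.
  apply/eqP; rewrite eq_le; apply/andP; split.
    by apply: bigmin_inf_seq ta _ _; rewrite ?Fax.
  by rewrite /theta big_seq; apply: le_bigmin => //; apply: FF; exact: mem_head.
exists theta, delta; split => //.
- by apply: thetaE; rewrite ?mem_head// subrr normr0 ltW.
- move=> x y; rewrite ler_norml; apply/andP; split.
    by have := theta_lip y x; rewrite distrC; lra.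
  by have := theta_lip x y; lra.
- by move=> a x sa; apply: thetaE; rewrite inE sa orbT.
Qed.

(** * Continuous approximations of bounded variation *)

(* The partial sums, rather than the terms, are recorded: this makes the
   notion stable under composition with Lipschitz functions. *)
Definition bounded_variation_limit (R : realType) (K : topologicalType)
    (u : K -> R) (M : R) : Prop :=
  0 <= M /\ exists S : nat -> K -> R,
    [/\ forall k, S 0%N k = 0, forall n, continuous (S n),
        forall k, S n k @[n --> \oo] --> u k &
        forall k n, \sum_(0 <= j < n) `|S j.+1 k - S j k| <= M].

Local Notation bvl := bounded_variation_limit.

Lemma bvlD (R : realType) (K : topologicalType) (u v : K -> R) (M N : R) :
  bvl u M -> bvl v N -> bvl (fun k => u k + v k) (M + N).
Proof.
move=> [M0 [S [S0 Sc Su SM]]] [N0 [T [T0 Tc Tv TN]]]; split.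
  exact: addr_ge0.
exists (fun n k => S n k + T n k); split => [k|n k|k|k n].
- by rewrite S0 T0 addr0.
- by apply: cvgD; [exact: Sc|exact: Tc].
- exact: cvgD.
- apply: le_trans (lerD (SM k n) (TN k n)); rewrite -big_split/=.
  by apply: ler_sum => j _; rewrite opprD addrACA ler_normD.
Qed.

Lemma bvl_lipschitz (R : realType) (K : topologicalType) (u : K -> R)
    (M L : R) (theta : R -> R) :
  0 <= L -> theta 0 = 0 -> (forall x y, `|theta x - theta y| <= L * `|x - y|) ->
  bvl u M -> bvl (theta \o u) (L * M).
Proof.
move=> L0 theta0 thetaL [M0 [S [S0 Sc Su SM]]]; split; first exact: mulr_ge0.
have thetac : continuous theta.
  move=> x; apply/cvgrPdist_le => e e0; near=> y.
  (* [L] may be zero; [L + 1] can be divided by. *)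
  rewrite (le_trans (thetaL x y))// (@le_trans _ _ ((L + 1) * `|x - y|))//.
    by rewrite ler_wpM2r// lerDl.
  rewrite -ler_pdivlMl; last lra.
  near: y; apply: cvgr_dist_le => //; rewrite mulr_gt0// invr_gt0; lra.
exists (fun n k => theta (S n k)); split => [k|n k|k|k n].
- by rewrite S0.
- exact: continuous_comp (Sc n k) (thetac _).
- exact: continuous_cvg (thetac _) (Su k).
- apply: (le_trans _ (ler_wpM2l L0 (SM k n))); rewrite mulr_sumr.
  by apply: ler_sum.
Unshelve. all: by end_near. Qed.

Lemma bvlB (R : realType) (K : topologicalType) (u v : K -> R) (M N : R) :
  bvl u M -> bvl v N -> bvl (fun k => u k - v k) (M + N).
Proof.
move=> uM vN; apply: bvlD uM _; rewrite -(mul1r N).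
apply: (bvl_lipschitz (theta := -%R) _ _ _ vN); rewrite ?ler01 ?oppr0// => x y.
by rewrite mul1r -opprD normrN.
Qed.

(** * Bounded lower semicontinuous functions *)

(** The Lipschitz regularisations [q n x], infima over [y] of [p y + n * d(x, y)], are continuous
    and increase to [p], so their variation telescopes. *)
Lemma bvl_lsc (R : realType) (K : metricType R) (p : K -> R) :
  bounded_lsc p -> exists M, bvl p M.
Proof.
move=> [[C [Creal /(_ (C + 1))]]]; rewrite ltrDl => /(_ ltr01).
move: (C + 1) => {Creal}C pC lscp.
have {}pC y : `|p y| <= C by exact: pC.
(* On an empty [K] the bound [C] may be negative, so this case is settled apart. *)
have [[x0 _]|K0] := pselect (exists x0 : K, True); last first.
  exists 0; split => //; exists (fun _ _ => 0).
  by split => [//|n k|k|k n]; case: K0; exists k.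
have C0 : 0 <= C by rewrite (le_trans _ (pC x0)).
pose A (n : nat) x := [set p y + n%:R * mdist x y | y in [set: K]].
pose q n x := inf (A n x).
have A0 n x : A n x !=set0 by exists (p x + n%:R * mdist x x), x.
have Alb n x : lbound (A n x) (- C).
  move=> _ [y _ <-]; have := pC y; rewrite ler_norml => /andP[h _].
  by rewrite (le_trans h)// lerDl mulr_ge0// mdist_ge0.
have q_le n x y : q n x <= p y + n%:R * mdist x y.
  by apply: ge_inf; [exists (- C); exact: Alb|exists y].
have q_ge n x : - C <= q n x by exact: lb_le_inf.
have q_lep n x : q n x <= p x.
  by have := q_le n x x; rewrite mdistxx mulr0 addr0.
have q_leC n x : q n x <= C.
  by rewrite (le_trans (q_lep n x))// (le_trans (ler_norm _)).
have q_incr n x : q n x <= q n.+1 x.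
  apply: lb_le_inf => // _ [y _ <-]; rewrite (le_trans (q_le n x y))// lerD2l.
  by rewrite ler_wpM2r ?mdist_ge0// ler_nat.
have q_lip n x x' : q n x <= q n x' + n%:R * mdist x x'.
  rewrite -lerBlDr; apply: lb_le_inf => // _ [y _ <-]; rewrite lerBlDr.
  rewrite (le_trans (q_le n x y))// -addrA -mulrDr lerD2l ler_wpM2l//.
  by rewrite addrC metric_triangle.
have q_cont n : continuous (q n).
  move=> x; apply/cvgrPdist_le => e e0.
  (* [n.+1] keeps the radius positive when [n = 0]. *)
  apply/nbhs_ballP; exists (e / n.+1%:R) => /=; first by rewrite divr_gt0.
  move=> y; rewrite ballEmdist/= => xy.
  have nxy : n%:R * mdist x y <= e.
    rewrite (@le_trans _ _ (n.+1%:R * mdist x y))//.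
      by rewrite ler_wpM2r ?mdist_ge0// ler_nat.
    by rewrite -ler_pdivlMl// mulrC ltW.
  have := q_lip n x y; have := q_lip n y x; rewrite (metric_sym y x) => h1 h2.
  by rewrite ler_norml; apply/andP; split; lra.
have q_cvg x : q n x @[n --> \oo] --> p x.
  apply/cvgrPdist_le => e e0.
  (* Points [y] within [r] of [x] satisfy [p y > p x - e] by semicontinuity; for the others the
     penalty is at least [n * r >= 2 * C >= p x - p y]. *)
  have [|V /nbhs_ballP[r /= r0 rV] Vp] := lscp x (p x - e).
    by rewrite /= lte_fin ltrBlDr ltrDl.
  near=> n.
  have nr : 2 * C <= n%:R * r.
    rewrite -ler_pdivrMr//; near: n.
    exact: nbhs_infty_ger.
  rewrite ger0_norm ?subr_ge0// lerBlDl -lerBlDr.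
  apply: lb_le_inf => // _ [y _ <-].
  have := pC x; have := pC y; rewrite !ler_norml => /andP[py _] /andP[_ px].
  have [xy|rxy] := ltP (mdist x y) r.
    have /Vp : V y by apply: rV; rewrite ballEmdist.
    rewrite /= lte_fin => /ltW/le_trans; apply.
    by rewrite lerDl mulr_ge0// mdist_ge0.
  have := ler_wpM2l (ler0n R n) rxy; lra.
(* The index shift makes the sequence start at 0. The jump from 0 to [q 0] costs at most [C], the
   later increase at most [2 * C]. *)
exists (3 * C); split; first lra.
exists (fun n k => if n is m.+1 then q m k else 0); split => //.
- by case=> [k|n]; [exact: cst_continuous|exact: q_cont].
- by move=> k; rewrite -cvg_shiftS; exact: q_cvg.
- move=> k [|n]; first by rewrite big_geq//; lra.
  rewrite big_nat_recl//= subr0.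
  rewrite (eq_bigr (fun j => q j.+1 k - q j k)); last first.
    by move=> j _; rewrite ger0_norm// subr_ge0.
  rewrite telescope_sumr//.
  have : `|q 0%N k| <= C by rewrite ler_norml q_ge q_leC.
  have := q_leC n k; have := q_ge 0%N k; lra.
Unshelve. all: by end_near. Qed.

(** * Complex moduli and limits *)

Lemma complex_normE (R : realType) (z : Cplx R) : `|z| = (normc z)%:C.
Proof. by case: z. Qed.

Lemma le_Re_normc (R : realType) (z : R[i]) : `|complex.Re z| <= normc z.
Proof. by rewrite -lecR; exact: normc_ge_Re. Qed.

Lemma normc_le_ReIm (R : realType) (z : R[i]) :
  normc z <= `|complex.Re z| + `|complex.Im z|.
Proof.
case: z => a b /=; rewrite -[leRHS]ger0_norm ?addr_ge0// -sqrtr_sqr.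
rewrite ler_wsqrtr//.
rewrite sqrrD !real_normK ?num_real// addrAC lerDl.
by rewrite mulrn_wge0 ?mulr_ge0.
Qed.

Lemma cvg_Re (R : realType) (T : Type) (F : set_system T) {FF : Filter F}
    (f : T -> Cplx R) (l : Cplx R) :
  f @ F --> l -> (fun t => complex.Re (f t)) @ F --> complex.Re l.
Proof.
move=> /cvgrPdist_lt fl; apply/cvgrPdist_lt => e e0.
have /fl : 0 < e%:C :> R[i] by rewrite ltcR.
apply: filterS => t; rewrite complex_normE ltcR; apply: le_lt_trans.
by rewrite -raddfB le_Re_normc.
Qed.

Lemma cvg_complex (R : realType) (T : Type) (F : set_system T) {FF : Filter F}
    (a b : T -> R) (x y : R) :
  a @ F --> x -> b @ F --> y ->
  (fun t => a t +i* b t : Cplx R) @ F --> (x +i* y : Cplx R).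
Proof.
move=> /cvgrPdist_lt ax /cvgrPdist_lt bY; apply/cvgrPdist_lt => -[e e'].
rewrite ltcE/= => /andP[/eqP -> e0]; have e20 : 0 < e / 2 by rewrite divr_gt0.
near=> t.
rewrite complex_normE ltcR (le_lt_trans (normc_le_ReIm _))// (splitr e)/=.
by apply: ltrD; near: t; [exact: ax|exact: bY].
Unshelve. all: by end_near. Qed.

(** * The series norm in terms of variation *)

Lemma sup_abs_sum_ge0 (R : realType) (K : metricType R)
    (phi : nat -> K -> Cplx R) :
  0 <= fine (sup_abs_sum phi).
Proof.
have [[k _]|K0] := pselect (exists k : K, True).
  apply: fine_ge0; apply: le_trans (ereal_sup_ubound _); last by exists k.
  by apply: nneseries_ge0 => j _ _; rewrite lee_fin;
    exact: le_trans (normr_ge0 _) (le_Re_normc _).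
(* On an empty [K] the supremum is [-oo], which [fine] sends to 0. *)
rewrite /sup_abs_sum (_ : [set _ | _ in _] = set0) ?ereal_sup0//.
by apply/seteqP; split => // t [k _ _]; case: K0; exists k.
Qed.

(** The approximations are the real parts of the partial sums of a series; strictness of the
    inequality supplies one whose bound is below [M], even if the infimum is not attained. *)
Lemma normD_bvl (R : realType) (K : metricType R) (f : K -> Cplx R) (M : R) :
  D_series f !=set0 -> normD f < M -> bvl (fun k => complex.Re (f k)) M.
Proof.
move=> f0 /inf_lt[|t [phi [phic phioo phif] <-] phiM].
  by case: f0 => phi phiD; exists (fine (sup_abs_sum phi)), phi.
have phi_le k n : \sum_(0 <= j < n) normc (phi j k) <= fine (sup_abs_sum phi).
  have le1 : ((\sum_(0 <= j < n) normc (phi j k))%:E <= sup_abs_sum phi)%E.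
    apply: le_trans (ereal_sup_ubound _); last by exists k.
    rewrite -sumEFin; apply: nneseries_lim_ge => j _ _.
    by rewrite lee_fin (le_trans (normr_ge0 _) (le_Re_normc _)).
  rewrite -lee_fin fineK// fin_numElt phioo andbT.
  by rewrite (lt_le_trans _ le1)// ltNyr.
have M0 := sup_abs_sum_ge0 phi.
have seriesc n : continuous (fun k => series (phi^~ k) n).
  elim: n => [|n IH].
    rewrite (_ : (fun k => _) = cst 0); first exact: cst_continuous.
    by apply/funext => x; rewrite /series/= big_geq.
  rewrite (_ : (fun k => _) = fun k => series (phi^~ k) n + phi n k).
    by move=> k; apply: cvgD; [exact: IH|exact: phic].
  by apply/funext => x; rewrite seriesSr.
split; first by rewrite (le_trans M0)// ltW.
exists (fun n k => complex.Re (series (fun j => phi j k) n)).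
split => [k|n k|k|k n].
- by rewrite /series/= big_geq.
- by apply: cvg_Re; exact: seriesc.
- by apply: cvg_Re; exact: phif.
- rewrite (le_trans _ (ltW phiM))// (le_trans _ (phi_le k n))//.
  by apply: ler_sum => j _; rewrite -raddfB seriesSB le_Re_normc.
Qed.

(** The terms are successive differences of the approximations, with modulus at most the sum of the
    absolute values of their two parts. *)
Lemma bvl_D_series (R : realType) (K : metricType R) (f : K -> Cplx R)
    (M N : R) :
  bvl (fun k => complex.Re (f k)) M -> bvl (fun k => complex.Im (f k)) N ->
  exists2 phi, D_series f phi & fine (sup_abs_sum phi) <= M + N.
Proof.
move=> [M0 [S [S0 Sc Su SM]]] [N0 [T [T0 Tc Tv TN]]].
pose phi j k : Cplx R := (S j.+1 k - S j k) +i* (T j.+1 k - T j k).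
have sup_le : (sup_abs_sum phi <= (M + N)%:E)%E.
  apply: ub_ereal_sup => _ [k _ <-]; apply: lime_le.
    apply: is_cvg_nneseries => j _ _.
    by rewrite lee_fin (le_trans (normr_ge0 _) (le_Re_normc _)).
  apply: nearW => n; rewrite sumEFin lee_fin.
  rewrite (le_trans _ (lerD (SM k n) (TN k n)))//.
  rewrite -big_split/=; apply: ler_sum => j _.
  exact: (normc_le_ReIm (phi j k)).
have phiS k n : series (phi^~ k) n = S n k +i* T n k.
  elim: n => [|n IH]; first by rewrite /series/= big_geq// S0 T0.
  by rewrite seriesSr IH; apply/eqP; rewrite eq_complex/= !subrKC !eqxx.
exists phi; last first.
  (* If the supremum is [-oo], [fine] returns 0, which is at most [M + N] as both are
     nonnegative. *)
  move: sup_le; case: (sup_abs_sum phi) => //= *; exact: addr_ge0.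
split => [j k||k].
- by apply: cvg_complex; apply: cvgB; [exact: Sc|exact: Sc|exact: Tc|exact: Tc].
- by rewrite (le_lt_trans sup_le)// ltry.
- rewrite (_ : series _ = fun n => S n k +i* T n k); last exact/funext/phiS.
  have -> : f k = complex.Re (f k) +i* complex.Im (f k) by case: (f k).
  by apply: cvg_complex.
Qed.

Lemma normD_ge0 (R : realType) (K : metricType R) (f : K -> Cplx R) :
  0 <= normD f.
Proof.
have [f0|/set0P f0] := eqVneq (D_series f) set0.
  by rewrite /normD f0 image_set0 inf0.
apply: lb_le_inf => [|_ [phi _ <-]]; last exact: sup_abs_sum_ge0.
by case: f0 => phi fphi; exists (fine (sup_abs_sum phi)), phi.
Qed.

Lemma normD_le (R : realType) (K : metricType R) (f : K -> Cplx R) (M N : R) :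
  bvl (fun k => complex.Re (f k)) M -> bvl (fun k => complex.Im (f k)) N ->
  normD f <= M + N.
Proof.
move=> fM fN; have [phi fphi phi_le] := bvl_D_series fM fN.
apply: le_trans phi_le; apply: ge_inf; last by exists phi.
by exists 0 => _ [psi _ <-]; exact: sup_abs_sum_ge0.
Qed.

(** This is the passage from semicontinuous functions to series: the bounds of the four functions
    add up in pairs. *)
Lemma classD_bvl (R : realType) (K : metricType R) (f : K -> Cplx R) :
  classD f ->
  exists M N, bvl (fun k => complex.Re (f k)) M /\
              bvl (fun k => complex.Im (f k)) N.
Proof.
move=> [p1 [p2 [p3 [p4 [/bvl_lsc[M1 h1] /bvl_lsc[M2 h2] /bvl_lsc[M3 h3]
  /bvl_lsc[M4 h4] ->]]]]].
by exists (M1 + M2), (M3 + M4); split; exact: bvlB.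
Qed.

Lemma bvl0 (R : realType) (K : topologicalType) : bvl (fun _ : K => 0 : R) 0.
Proof.
split => //; exists (fun _ _ => 0); split => // [n|k|k n].
- exact: cst_continuous.
- exact: cvg_cst.
- by rewrite big1// => j _; rewrite subrr normr0.
Qed.

Lemma uniform_cvg_near (R : realType) (K : metricType R)
    (f_ : nat -> K -> Cplx R) (f : K -> Cplx R) (e : R) :
  {uniform, f_ @ \oo --> f} -> 0 < e ->
  exists n, forall k, normc (f k - f_ n k) < e.
Proof.
move=> f_f e0.
have /f_f [N _ /(_ N)] : nbhs (f : {uniform K -> Cplx R})
    [set g | forall k, normc (f k - g k) < e].
  apply/uniform_nbhs; exists [set zw : Cplx R * Cplx R | `|zw.1 - zw.2| < e%:C].
  have ec0 : 0 < e%:C :> R[i] by rewrite ltcR.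
  split; first exact: (@entourage_ball _ (Cplx R) (PosNum ec0)).
  by move=> g fg k; have := fg k I; rewrite /= complex_normE ltcR.
by move=> /(_ (leqnn _)) h; exists N.
Qed.

Lemma classD_D_series (R : realType) (K : metricType R) (f : K -> Cplx R) :
  classD f -> D_series f !=set0.
Proof.
move=> /classD_bvl[M [N [fM fN]]].
by have [phi fphi _] := bvl_D_series fM fN; exists phi.
Qed.

(** Since [normD] is 0 when no series exists, [normD (f \- g) < e] is informative only once a series
    for [f \- g] is known. *)
Lemma classDB_D_series (R : realType) (K : metricType R) (f g : K -> Cplx R) :
  classD f -> classD g -> D_series (f \- g) !=set0.
Proof.
move=> /classD_bvl[M [N [fM fN]]] /classD_bvl[M' [N' [gM gN]]].
have [||phi phiD _] := @bvl_D_series R K (f \- g) (M + M') (N + N').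
- rewrite (_ : (fun k => _) = fun k => complex.Re (f k) - complex.Re (g k)).
    exact: bvlB.
  by apply/funext => k; rewrite /= raddfB.
- rewrite (_ : (fun k => _) = fun k => complex.Im (f k) - complex.Im (g k)).
    exact: bvlB.
  by apply/funext => k; rewrite /= raddfB.
- by exists phi.
Qed.

(** * Equality of the two norms for real functions *)

Theorem corollary6 (R : realType) (K : metricType R) (f : K -> Cplx R)
    (hf : classSD f) (hreal : forall k : K, complex.Im (f k) = 0) :
  normB14 f = normD f.
Proof.
have [fD fS] := hf.
(* The constant sequence [f] will give [normB14 f <= normD f]. *)
have cst_bound : B14_bounds f (normD f).
  by exists (fun _ => f); split => //; exact: (@cvg_cst {uniform K -> Cplx R}).
have bounds_ge0 : lbound (B14_bounds f) 0.
  by move=> M [f_ [_ _ /(_ 0%N)]]; apply: le_trans; exact: normD_ge0.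
apply/eqP; rewrite eq_le; apply/andP; split.
  by apply: ge_inf => //; exists 0.
apply: lb_le_inf => [|M M_bound]; first by exists (normD f).
have M0 := bounds_ge0 M M_bound; have [f_ [f_D f_f f_M]] := M_bound.
have {}M5 : 0 < M + 5 by lra.
(* The final bound is [(1 + e) * (M + 2 * e) + e = M + e * (M + 3 + 2 * e)], at most [M + e'] since
   [e <= 1]. *)
apply/ler_addgt0Pl => e' e'0; pose e := Num.min 1 (e' / (M + 5)).
have e0 : 0 < e by rewrite lt_min ltr01 divr_gt0.
have e1 : e <= 1 by rewrite ge_min lexx.
have eM : e * (M + 5) <= e' by rewrite -ler_pdivlMr// ge_min lexx orbT.
have [g [gD /finite_seqP[s gs]] fg] := fS e e0.
have [|theta [delta [delta0 theta0 theta_lip thetaE]]] :=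
  @flat_lipschitz R [seq complex.Re z | z <- s] (1 + e); first by rewrite ltrDl.
have [n fn] := uniform_cvg_near f_f delta0.
have fn_bvl : bvl (fun k => complex.Re (f_ n k)) (M + e).
  apply: normD_bvl; first exact/classD_D_series.
  by rewrite (le_lt_trans (f_M n))// ltrDl.
have fg_bvl : bvl (fun k => complex.Re ((f \- g) k)) e.
  by apply: normD_bvl => //; exact: classDB_D_series.
(* The argument of [theta] differs from the real part of [g k] by that of [f_ n k - f k], hence by
   less than [delta]. *)
have g_theta k :
    theta (complex.Re (f_ n k) - complex.Re ((f \- g) k)) = complex.Re (g k).
  apply: thetaE.
    by apply: map_f; have : range g (g k) by []; rewrite gs.
  rewrite -!raddfB (_ : _ - _ = - (f k - f_ n k)) /=; last by ring.
  by rewrite raddfN normrN (le_trans (le_Re_normc _))// ltW.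
(* [f_ n] contributes [M + e], [f \- g] contributes [e], and [theta] the factor [1 + e]; restoring
   [f \- g] costs the last [e]. *)
have f_bvl : bvl (fun k => complex.Re (f k)) ((1 + e) * (M + e + e) + e).
  rewrite (_ : (fun k => _) = fun k =>
     theta (complex.Re (f_ n k) - complex.Re ((f \- g) k))
     + complex.Re ((f \- g) k)).
    apply: bvlD => //; apply: bvl_lipschitz => //; first lra.
    exact: bvlB.
  by apply/funext => k; rewrite g_theta /= raddfB subrKC.
(* As [f] is real-valued, the imaginary part adds nothing to the bound from [normD_le]. *)
have f_bvl0 : bvl (fun k => complex.Im (f k)) 0.
  by rewrite (_ : (fun k => _) = fun=> 0); [exact: bvl0|exact/funext].
apply: le_trans (normD_le f_bvl f_bvl0) _; nra.
Qed.
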